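(* Let $k>2$ be an even integer and let $n$ be a positive integer that is a multiple of $k$. Then $$(n/k)!\;\leq\; M(n,k)\;\leq\; 3^n\,(n/k)!,$$ where $M(n,k)$ is the maximum size of a family of Hamilton paths in the complete graph $K_n$ such that for any two distinct members of the family there is a subpath with $k$ edges (on $k+1$ vertices) of one of the two Hamilton paths that is edge-disjoint from the whole of the other Hamilton path.
   Context: $K_n$ is the complete graph with vertex set $[n]=\{1,\dots,n\}$. Hamilton paths are undirected: a Hamilton path in $K_n$ is a subgraph that is a path visiting all $n$ vertices, identified with its edge set (so a vertex ordering and its reversal give the same Hamilton path). A subpath with $k$ edges of a Hamilton path consists of $k$ consecutive edges of it. *)

(* Defs.v *)
From mathcomp Require Import all_boot.

Set Implicit Arguments.
Unset Strict Implicit.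
Unset Printing Implicit Defensive.

Section HamiltonPaths.

Variable n : nat.

(* The vertices of K_n are the elements of 'I_n, and its edges are the
   two-element sets of vertices. *)
Definition path_edges (s : seq 'I_n) : {set {set 'I_n}} :=
  [set e in [seq [set p.1; p.2] | p <- zip s (behead s)]].

(* [s] lists every vertex exactly once, because it has [n] distinct entries. *)
Definition traverses (s : n.-tuple 'I_n) (H : {set {set 'I_n}}) : bool :=
  uniq s && (H == path_edges s).

Definition hamilton_path (H : {set {set 'I_n}}) : bool :=
  [exists s : n.-tuple 'I_n, traverses s H].

Definition subpath (k : nat) (P H : {set {set 'I_n}}) : bool :=
  [exists s : n.-tuple 'I_n, exists t : k.+1.-tuple 'I_n,
     [&& traverses s H, infix t s & P == path_edges t]].

Definition locally_separated (k : nat) (H H' : {set {set 'I_n}}) : bool :=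
  [exists P : {set {set 'I_n}},
     (subpath k P H && [disjoint P & H'])
     || (subpath k P H' && [disjoint P & H])].

Definition separated_family (k : nat) (F : {set {set {set 'I_n}}}) : bool :=
  [forall H in F, hamilton_path H]
  && [forall H in F, forall H' in F, (H != H') ==> locally_separated k H H'].

End HamiltonPaths.

Definition M (n k : nat) : nat :=
  \max_(F : {set {set {set 'I_n}}} | separated_family k F) #|F|.

(* Main.v *)
(** Lower bound: write [n = m * k]. For a permutation [pi] of the [m] blocks of
    [k] consecutive positions, keep vertex [p] at every even position [p] and
    move the odd-numbered vertices of block [pi i] to the odd positions of block
    [i]. If [pi i <> si i], the [k] edges of the [pi]-path that start inside block
    [i] are missing from the [si]-path: an edge of either path joins an even vertex,
    which sits at its own position, to an odd one, so a common edge would put the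
    odd vertex at two positions that differ by at most 2 and agree modulo [k > 2].

    Upper bound: orient every path of the family and keep its edges that start
    at positions divisible by [k]. Every subpath with [k] edges contains one of
    them, so two members of the family that yield the same oriented edges are
    equal. These [m] edges are determined by the residue of each position
    (0, 1 or other), for which there are at most [3 ^ n] choices, and by a
    matching of the sources with the targets, for which there are [m!]. *)

Require Import Defs.
From mathcomp Require Import all_boot fingroup perm zify.

(** * Edges and subpaths in terms of positions along a traversal *)

Lemma path_edgesP {n} (x0 : 'I_n) (s : seq 'I_n) (e : {set 'I_n}) :
  reflect (exists2 p, p.+1 < size s & e = [set nth x0 s p; nth x0 s p.+1])
          (e \in path_edges s).
Proof.
rewrite inE; apply: (iffP mapP) => [[[u v] /(nthP (x0, x0)) [p ltp Ep] ->]|[p ltp ->]].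
  exists p; first by move: ltp; rewrite size_zip size_behead ltn_min ltn_predRL => /andP[].
  move: Ep; rewrite nth_zip_cond ltp.
  by rewrite nth_behead => -[-> ->].
exists (nth x0 s p, nth x0 s p.+1) => //.
apply/(nthP (x0, x0)).
have ltz : p < size (zip s (behead s)).
  by rewrite size_zip size_behead ltn_min ltn_predRL ltp ltnW.
by exists p; rewrite // nth_zip_cond ltz nth_behead.
Qed.

Lemma subpathP {n} (x0 : 'I_n) (k : nat) (P H : {set {set 'I_n}}) :
  subpath k P H ->
  exists2 s : n.-tuple 'I_n, traverses s H &
    exists2 j, j + k < n & forall p, j <= p < j + k ->
      [set nth x0 s p; nth x0 s p.+1] \in P.
Proof.
case/existsP=> s /existsP[t /and3P[tr_s /infixP[a [b Es]] /eqP->]].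
exists s => //; have := congr1 size Es; rewrite !size_cat !size_tuple => En.
exists (size a); first lia.
move=> p p_win; apply/(path_edgesP x0); exists (p - size a).
  by rewrite size_tuple; lia.
have nthE q : size a <= q <= size a + k -> nth x0 s q = nth x0 t (q - size a).
  case/andP=> a_le q_le; rewrite Es nth_cat ltnNge a_le nth_cat size_tuple ifT //.
  by rewrite ltnS leq_subLR.
case/andP: p_win => a_le lt_p.
by rewrite !nthE ?subSn ?a_le ?(ltnW lt_p) // (leq_trans a_le).
Qed.

Lemma nth_inj {n} (x0 : 'I_n) (s : n.-tuple 'I_n) (p q : nat) :
  uniq s -> p < n -> q < n -> nth x0 s p = nth x0 s q -> p = q.
Proof.
by move=> s_uniq ltp ltq /eqP; rewrite nth_uniq ?size_tuple // => /eqP.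
Qed.

Lemma mem_uniq_tuple {n} (s : n.-tuple 'I_n) (v : 'I_n) : uniq s -> v \in s.
Proof.
move=> s_uniq; have Es : #|s| = #|'I_n| by rewrite (card_uniqP s_uniq) size_tuple card_ord.
by rewrite (subset_cardP Es (subset_predT _)).
Qed.

(** Both orderings have the same edge set, so an edge of [t] is an edge of [s], read in one of two
    directions. This local form makes it unnecessary to show that [t] is [s] or its reversal. *)
Lemma traverses_step {n} (x0 : 'I_n) (s t : n.-tuple 'I_n) (H : {set {set 'I_n}}) (p : nat) :
  traverses s H -> traverses t H -> p.+1 < n ->
  let f q := index (nth x0 t q) s in
  f p.+1 = (f p).+1 \/ f p = (f p.+1).+1.
Proof.
case/andP=> s_uniq /eqP Hs /andP[t_uniq /eqP Ht] ltp f.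
have /(path_edgesP x0) [q] : [set nth x0 t p; nth x0 t p.+1] \in path_edges s.
  by rewrite -Hs Ht; apply/(path_edgesP x0); exists p; rewrite ?size_tuple.
rewrite size_tuple => ltq E; rewrite /f.
have tN : nth x0 t p != nth x0 t p.+1.
  by apply/eqP => /(nth_inj _ _ _ _ t_uniq) => /(_ (ltnW ltp) ltp); lia.
have := set21 (nth x0 t p) (nth x0 t p.+1).
have := set22 (nth x0 t p) (nth x0 t p.+1).
(* Matching both vertices with the same endpoint contradicts [tN]; the two remaining cases are the
   two directions. *)
rewrite E => /set2P[] E1 /set2P[] E2; rewrite E1 E2 ?eqxx // in tN *;
  rewrite !index_uniq ?size_tuple ?(ltnW ltq) //; by [left | right].
Qed.

(** A walk on the integers by unit steps that never repeats a value cannot turn back. *)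
Lemma unit_steps (f : nat -> nat) (j k : nat) :
  (forall p, j <= p < j + k -> f p.+1 = (f p).+1 \/ f p = (f p.+1).+1) ->
  (forall p q, p <= j + k -> q <= j + k -> f p = f q -> p = q) ->
  (forall i, i <= k -> f (j + i) = f j + i) \/
  (forall i, i <= k -> f (j + i) + i = f j).
Proof.
elim: k => [|k IHk] f_step f_inj; first by left=> -[|//] _; rewrite !addn0.
have [k0|k_gt0] := posnP k.
  have [|E|E] := f_step j; [lia | left | right] => -[|i] lei; rewrite ?addn0 //;
    have -> : i = 0 by [lia]; rewrite (addn1 j); lia.
(* A turn at [j + k] would revisit the value taken one step before. *)
have back : f (j + k.-1) = f (j + k).+1 -> False.
  move=> Ef; have : j + k.-1 = (j + k).+1 by apply: f_inj Ef; lia.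
  by lia.
have [||up|down] := IHk; [by move=> p ?; apply: f_step; lia
  | by move=> p q ? ?; apply: f_inj; lia | left | right] => i;
  rewrite leq_eqVlt => /predU1P[->|ltik]; try (by [apply: up | apply: down]);
  have [|E|E] := f_step (j + k); try lia.
- by have := up k (leqnn _); rewrite (addnS j); lia.
- by case: back; have := up k (leqnn _); have := up k.-1 (leq_pred _); lia.
- by case: back; have := down k (leqnn _); have := down k.-1 (leq_pred _); lia.
- by have := down k (leqnn _); rewrite (addnS j); lia.
Qed.

(** By monotonicity the lower ends of the [k] steps are [k] consecutive integers, one of which is a
    multiple of [k]. *)
Lemma unit_steps_dvdn (f : nat -> nat) (j k : nat) :
  0 < k ->
  (forall p, j <= p < j + k -> f p.+1 = (f p).+1 \/ f p = (f p.+1).+1) ->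
  (forall p q, p <= j + k -> q <= j + k -> f p = f q -> p = q) ->
  exists2 p, j <= p < j + k & k %| minn (f p) (f p.+1).
Proof.
move=> k_gt0 f_step f_inj; case: (unit_steps _ _ _ f_step f_inj) => Ef.
  (* Rising case: [d * k] is the least multiple of [k] that is at least [f j]. *)
  have := divn_eq (f j + k.-1) k; have := ltn_pmod (f j + k.-1) k_gt0.
  set d := _ %/ k; set r := _ %% k => ltr Ed.
  exists (j + (k.-1 - r)); first lia.
  rewrite -addnS !Ef; try lia.
  by apply/dvdnP; exists d; lia.
(* Falling case: [d * k] is the greatest multiple of [k] below [f j]. The predecessor is not
   truncated, because [Ek] below gives [k <= f j]. *)
have := divn_eq (f j).-1 k; have := ltn_pmod (f j).-1 k_gt0.
set d := _ %/ k; set r := _ %% k => ltr Ed.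
have := Ef r (ltnW ltr); have := Ef r.+1 ltr; have := Ef _ (leqnn k) => Ek Er1 Er.
exists (j + r); first lia.
by rewrite -addnS; apply/dvdnP; exists d; lia.
Qed.

Lemma subpath_dvdn_edge {n} (x0 : 'I_n) (k : nat) (P H : {set {set 'I_n}})
    (s : n.-tuple 'I_n) :
  0 < k -> traverses s H -> subpath k P H ->
  exists2 p, k %| p & (p.+1 < n) && ([set nth x0 s p; nth x0 s p.+1] \in P).
Proof.
move=> k_gt0 tr_s /(subpathP x0)[t tr_t [j ltj tP]].
have /andP[s_uniq _] := tr_s; have /andP[t_uniq _] := tr_t.
have nth_index q : nth x0 s (index (nth x0 t q) s) = nth x0 t q.
  by rewrite nth_index ?mem_uniq_tuple.
pose f q := index (nth x0 t q) s.
have ltf q : f q < n by rewrite -[X in _ < X](size_tuple s) index_mem mem_uniq_tuple.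
have f_step p : j <= p < j + k -> f p.+1 = (f p).+1 \/ f p = (f p.+1).+1.
  by move=> p_win; apply: (traverses_step x0 _ _ _ _ tr_s tr_t); lia.
have [|p p_win dvd_p] := unit_steps_dvdn f j k k_gt0 f_step.
  move=> p q lep leq Ef; apply: (nth_inj x0 t); rewrite ?t_uniq //; try lia.
  by rewrite -nth_index -/(f p) Ef nth_index.
exists (minn (f p) (f p.+1)) => //.
have := tP p p_win; rewrite -(nth_index p) -(nth_index p.+1) -/(f p) -/(f p.+1).
have := ltf p; have := ltf p.+1; case: (f_step _ p_win) => ->.
  by rewrite (minn_idPl (leqnSn _)) => -> _ ->.
by rewrite (minn_idPr (leqnSn _)) setUC => _ -> ->.
Qed.

(** * A fixed orientation of each Hamilton path *)

Definition walk {n} (H : {set {set 'I_n}}) : n.-tuple 'I_n :=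
  odflt (ord_tuple n) [pick s | traverses s H].

Definition position {n} (H : {set {set 'I_n}}) (v : 'I_n) : nat := index v (walk H).

(* Equal to [v] itself when [v] is the last vertex of the walk. *)
Definition successor {n} (H : {set {set 'I_n}}) (v : 'I_n) : 'I_n :=
  nth v (walk H) (position H v).+1.

Lemma walkP {n} (H : {set {set 'I_n}}) : hamilton_path H -> traverses (walk H) H.
Proof.
by move=> /existsP[s tr_s]; rewrite /walk; case: pickP => //= /(_ s); rewrite tr_s.
Qed.

Lemma walk_uniq {n} (H : {set {set 'I_n}}) : hamilton_path H -> uniq (walk H).
Proof. by move/walkP/andP=> []. Qed.

Lemma nth_position {n} (x0 : 'I_n) (H : {set {set 'I_n}}) (v : 'I_n) :
  hamilton_path H -> nth x0 (walk H) (position H v) = v.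
Proof. by move=> hH; rewrite nth_index // mem_uniq_tuple // walk_uniq. Qed.

Lemma position_nth {n} (x0 : 'I_n) (H : {set {set 'I_n}}) (p : nat) :
  hamilton_path H -> p < n -> position H (nth x0 (walk H) p) = p.
Proof. by move=> hH ltp; rewrite /position index_uniq ?size_tuple // walk_uniq. Qed.

Lemma position_inj {n} (H : {set {set 'I_n}}) :
  hamilton_path H -> injective (position H).
Proof. by move=> hH u v E; rewrite -(nth_position u _ u hH) E nth_position. Qed.

Lemma position_lt {n} (H : {set {set 'I_n}}) (v : 'I_n) :
  hamilton_path H -> position H v < n.
Proof.
by move=> hH; rewrite -[X in _ < X](size_tuple (walk H)) index_mem mem_uniq_tuple ?walk_uniq.
Qed.

Lemma position_successor {n} (H : {set {set 'I_n}}) (v : 'I_n) :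
  hamilton_path H -> (position H v).+1 < n ->
  position H (successor H v) = (position H v).+1.
Proof. by move=> hH ltv; rewrite position_nth. Qed.

Lemma successor_edge {n} (H : {set {set 'I_n}}) (v : 'I_n) :
  hamilton_path H -> (position H v).+1 < n -> [set v; successor H v] \in H.
Proof.
move=> hH ltv; have /andP[_ /eqP EH] := walkP _ hH.
suff: [set v; successor H v] \in path_edges (walk H) by rewrite -EH.
apply/(path_edgesP v); exists (position H v); first by rewrite size_tuple.
by rewrite nth_position.
Qed.

(** The last position [n - 1] is not a multiple of [k], so every kept edge really exists. *)
Lemma ltn_dvdn_succ (k n p : nat) : 1 < k -> k %| n -> k %| p -> p < n -> p.+1 < n.
Proof. by move=> k_gt1 /dvdnP[a ->] /dvdnP[b ->]; rewrite ltn_pmul2r; nia. Qed.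

(** [P] contains an edge starting at a multiple of [k] along [walk H], and by [same] this edge also
    lies in [H']. *)
Lemma subpath_meets {n} (k : nat) (P H H' : {set {set 'I_n}}) :
  1 < k -> 0 < n -> k %| n -> hamilton_path H -> hamilton_path H' ->
  (forall v, k %| position H v ->
     k %| position H' v /\ successor H v = successor H' v) ->
  subpath k P H -> ~~ [disjoint P & H'].
Proof.
move=> k_gt1 n_gt0 dvd_n hH hH' same subP; pose x0 := Ordinal n_gt0.
have [|p dvd_p] := subpath_dvdn_edge x0 k P H (walk H) _ (walkP _ hH) subP; first lia.
case/andP=> ltp; set v := nth x0 _ p.
have Ev : position H v = p by rewrite position_nth // ltnW.
have <- : successor H v = nth x0 (walk H) p.+1.
  by rewrite /successor Ev; apply: set_nth_default; rewrite size_tuple.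
have [|dvd_v ->] := same v; first by rewrite Ev.
have vH' : [set v; successor H' v] \in H'.
  by apply: successor_edge; rewrite // (ltn_dvdn_succ k) ?position_lt.
by move=> vP; apply/negP => dPH'; rewrite (disjointFr dPH' vP) in vH'.
Qed.

(** * Upper bound: residue classes and matchings *)

(** Value 0 marks the sources of the kept edges, 1 their targets, and 2 all other vertices. *)
Definition residues {n} (k : nat) (H : {set {set 'I_n}}) : {ffun 'I_n -> 'I_3} :=
  [ffun v => inord (minn (position H v %% k) 2)].

Lemma eq_residues {n} (k : nat) (H H' : {set {set 'I_n}}) (v : 'I_n) (r : nat) :
  residues k H = residues k H' -> r < 2 ->
  position H v %% k = r -> position H' v %% k = r.
Proof.
move=> /ffunP/(_ v); rewrite !ffunE => /(congr1 val) /=.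
by rewrite !inordK ?ltnS ?geq_minr //; lia.
Qed.

Section Fiber.

Variables (n k m : nat) (F : {set {set {set 'I_n}}}) (H0 : {set {set 'I_n}}).
Hypotheses (k_gt2 : 2 < k) (n_gt0 : 0 < n) (nE : n = m * k).
Hypotheses (sepF : separated_family k F) (H0F : H0 \in F).

Let fiber := [set H in F | residues k H == residues k H0].

Let start (i : 'I_m) : 'I_n := nth (Ordinal n_gt0) (walk H0) (i * k).

(* The vertices whose position has residue 0 or 1 are numbered by their position
   in [H0], and the matching induced by [H] becomes a map on ['I_m]. The default
   of [insubd] is not reached for [H] in [fiber]. *)
Definition matching (H : {set {set 'I_n}}) : {ffun 'I_m -> 'I_m} :=
  [ffun i => insubd i (position H0 (successor H (start i)) %/ k)].

Let hamF H : H \in F -> hamilton_path H.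
Proof. by case/andP: sepF => /forall_inP hF _; apply: hF. Qed.

Let position_start i : position H0 (start i) = i * k.
Proof. by rewrite position_nth ?hamF // nE ltn_pmul2r //; lia. Qed.

Let position_start_dvdn i H : H \in fiber -> k %| position H (start i).
Proof.
rewrite inE => /andP[HF /eqP EH]; apply/eqP.
by apply: (eq_residues _ _ _ _ _ (esym EH)); rewrite // position_start modnMl.
Qed.

Let position_start_lt i H : H \in fiber -> (position H (start i)).+1 < n.
Proof.
move=> Hfib; apply: (@ltn_dvdn_succ k); [lia | by rewrite nE dvdn_mull | |].
  exact: position_start_dvdn.
by apply: position_lt; apply: hamF; move: Hfib; rewrite inE => /andP[].
Qed.

(** A target has residue 1 along [H], hence also along the reference path [H0], so the quotient by
    [k] loses no information. *)
Let matchingE i H : H \in fiber ->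
  position H0 (successor H (start i)) = matching H i * k + 1.
Proof.
move=> Hfib; have := Hfib; rewrite inE => /andP[HF /eqP EH].
have res1 : position H0 (successor H (start i)) %% k = 1.
  apply: (eq_residues _ _ _ _ _ EH) => //.
  rewrite position_successor ?hamF ?position_start_lt // -addn1 -modnDml.
  by rewrite (eqP (position_start_dvdn i _ Hfib)) modn_small //; lia.
rewrite [LHS](divn_eq _ k) res1 ffunE val_insubd ifT //.
by rewrite ltn_divLR -?nE ?position_lt ?hamF //; lia.
Qed.

Let matching_inj H : H \in fiber -> injective (matching H).
Proof.
move=> Hfib i j Eij; have := Hfib; rewrite inE => /andP[/hamF hH _].
have /(position_inj _ (hamF _ H0F))/(congr1 (position H)) :
    position H0 (successor H (start i)) = position H0 (successor H (start j)).
  by rewrite !matchingE // Eij.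
rewrite !position_successor ?position_start_lt // => -[] /(position_inj _ hH).
move/(congr1 (position H0)); rewrite !position_start => /eqP.
by rewrite eqn_pmul2r ?(ltnW (ltnW k_gt2)) // => /eqP/val_inj.
Qed.

Let matching_same H H' : H \in fiber -> H' \in fiber -> matching H = matching H' ->
  forall v, k %| position H v -> k %| position H' v /\ successor H v = successor H' v.
Proof.
move=> Hfib Hfib' E v /eqP dvd_v.
have := Hfib; rewrite inE => /andP[/hamF hH /eqP EH].
have dvd_v0 : position H0 v %% k = 0 by apply: eq_residues EH _ dvd_v.
have lt_v : position H0 v %/ k < m.
  by rewrite ltn_divLR -?nE ?position_lt ?hamF //; lia.
have -> : v = start (Ordinal lt_v).
  apply: (position_inj _ (hamF _ H0F)); rewrite position_start /=.
  by rewrite [LHS](divn_eq _ k) dvd_v0 addn0.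
split; first exact: position_start_dvdn.
by apply: (position_inj _ (hamF _ H0F)); rewrite !matchingE // E.
Qed.

(** Two members with the same matching share all kept edges, so by [subpath_meets] they are not
    separated and must coincide. Thus [matching] embeds the fiber into the injective self-maps of
    ['I_m]. *)
Lemma card_fiber : #|fiber| <= m`!.
Proof.
have injg : {in fiber &, injective matching}.
  move=> H H' Hfib Hfib' E; apply/eqP/negPn/negP => neq.
  have := Hfib; have := Hfib'; rewrite !inE => /andP[HF' _] /andP[HF _].
  have k_gt1 := ltnW k_gt2.
  have dvd_n : k %| n by rewrite nE dvdn_mull.
  case/andP: sepF => _ /forall_inP/(_ H HF)/forall_inP/(_ H' HF').
  move/implyP/(_ neq)/existsP=> [P /orP[] /andP[subP]]; apply/negP;
    apply: subpath_meets subP; rewrite ?hamF //; exact: matching_same.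
rewrite -(card_in_imset injg) -ffactnn -[in X in _ <= X](card_ord m) -card_inj_ffuns.
apply/subset_leq_card/subsetP=> _ /imsetP[H Hfib ->].
by rewrite inE; apply/injectiveP/matching_inj.
Qed.

End Fiber.

Lemma separated_family_card {n} (k m : nat) (F : {set {set {set 'I_n}}}) :
  2 < k -> 0 < n -> n = m * k -> separated_family k F -> #|F| <= 3 ^ n * m`!.
Proof.
move=> k_gt2 n_gt0 nE sepF.
rewrite -sum1_card (partition_big (residues k) xpredT) //=.
apply: (@leq_trans (\sum_(c : {ffun 'I_n -> 'I_3}) m`!)); last first.
  by rewrite sum_nat_const card_ffun !card_ord.
apply: leq_sum => c _; rewrite sum1dep_card.
(* Any member of a nonempty class serves as the reference path. *)
have [->|[H0]] := set_0Vmem [set H in F | residues k H == c]; first by rewrite cards0.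
by rewrite inE => /andP[H0F /eqP <-]; apply: card_fiber sepF H0F.
Qed.

(** * Lower bound: the paths indexed by permutations of the blocks *)

Lemma ord_mul_gt0 {m k} (p : 'I_(m * k)) : 0 < k.
Proof. by have := leq_ltn_trans (leq0n p) (ltn_ord p); rewrite muln_gt0 => /andP[]. Qed.

Lemma block_subproof (m k : nat) (p : 'I_(m * k)) : p %/ k < m.
Proof. by rewrite ltn_divLR ?ltn_ord // (ord_mul_gt0 p). Qed.

Definition block {m k} (p : 'I_(m * k)) : 'I_m := Ordinal (block_subproof m k p).

Definition zigzag {m} k (pi : {perm 'I_m}) (p : 'I_(m * k)) : 'I_(m * k) :=
  if odd p then insubd p (pi (block p) * k + p %% k) else p.

Definition zigzag_path {m} k (pi : {perm 'I_m}) : {set {set 'I_(m * k)}} :=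
  path_edges (map (zigzag k pi) (enum 'I_(m * k))).

Lemma zigzag_even {m k} (pi : {perm 'I_m}) (p : 'I_(m * k)) : ~~ odd p -> zigzag k pi p = p.
Proof. by rewrite /zigzag => /negPf->. Qed.

Lemma zigzag_odd {m k} (pi : {perm 'I_m}) (p : 'I_(m * k)) :
  odd p -> zigzag k pi p = pi (block p) * k + p %% k :> nat.
Proof.
rewrite /zigzag => ->; rewrite val_insubd ifT //.
have k_gt0 := ord_mul_gt0 p.
have := ltn_ord (pi (block p)); have := ltn_pmod p k_gt0; nia.
Qed.

(** Since [k] is even, moving a position by whole blocks keeps its parity. *)
Lemma odd_zigzag {m k} (pi : {perm 'I_m}) (p : 'I_(m * k)) :
  ~~ odd k -> odd (zigzag k pi p) = odd p.
Proof.
move=> /negPf k_even; have [odd_p|even_p] := boolP (odd p); last first.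
  by rewrite zigzag_even // (negPf even_p).
by rewrite zigzag_odd // oddD oddM k_even andbF odd_mod.
Qed.

Lemma eq_zigzag_odd {m k} (pi si : {perm 'I_m}) (p q : 'I_(m * k)) :
  odd p -> odd q -> zigzag k pi p = zigzag k si q ->
  pi (block p) = si (block q) /\ p = q %[mod k].
Proof.
move=> odd_p odd_q /(congr1 val) /=; rewrite !zigzag_odd // => E.
have k_gt0 := ord_mul_gt0 p.
split.
  apply/val_inj; move/(congr1 (divn^~ k)): E.
  by rewrite !divnMDl // !divn_small ?ltn_pmod // !addn0.
by move/(congr1 (modn^~ k)): E; rewrite !modnMDl !modn_mod.
Qed.

Lemma zigzag_inj {m k} (pi : {perm 'I_m}) : ~~ odd k -> injective (zigzag k pi).
Proof.
move=> k_even p q E; have Eodd := congr1 (odd \o val) E.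
rewrite /= !odd_zigzag // in Eodd.
have [odd_p|even_p] := boolP (odd p).
  have [|/perm_inj/(congr1 val)/= Ediv Emod] := eq_zigzag_odd pi pi p q odd_p _ E.
    by rewrite -Eodd.
  by apply/val_inj; rewrite /= (divn_eq p k) (divn_eq q k) Ediv Emod.
by rewrite !zigzag_even -?Eodd // in E.
Qed.

Definition zigzag_tuple {m} k (pi : {perm 'I_m}) : (m * k).-tuple 'I_(m * k) :=
  map_tuple (zigzag k pi) (ord_tuple (m * k)).

Lemma nth_zigzag_tuple {m k} (pi : {perm 'I_m}) (x0 p : 'I_(m * k)) :
  nth x0 (zigzag_tuple k pi) p = zigzag k pi p.
Proof.
rewrite (nth_map x0) ?size_enum_ord //.
by rewrite val_ord_tuple nth_ord_enum.
Qed.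

Lemma zigzag_traverses {m k} (pi : {perm 'I_m}) :
  ~~ odd k -> traverses (zigzag_tuple k pi) (zigzag_path k pi).
Proof.
move=> k_even; rewrite /traverses map_inj_uniq ?val_ord_tuple ?enum_uniq /=.
  by rewrite /zigzag_path.
exact: zigzag_inj.
Qed.

(** Normal form of an edge: [e] is both the even vertex and its position, [o] is the position of the
    odd vertex. *)
Lemma zigzag_edge {m k} (pi : {perm 'I_m}) (p q : 'I_(m * k)) :
  q = p.+1 :> nat ->
  exists e o : 'I_(m * k),
    [/\ ~~ odd e, odd o, e = p /\ o = q \/ e = q /\ o = p &
     [set zigzag k pi p; zigzag k pi q] = [set e; zigzag k pi o]].
Proof.
move=> Eq; have [odd_p|even_p] := boolP (odd p).
  have even_q : ~~ odd q by rewrite Eq /= negbK.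
  by exists q, p; split; auto; rewrite setUC (zigzag_even _ q).
have odd_q : odd q by rewrite Eq.
by exists p, q; split; auto; rewrite (zigzag_even _ p).
Qed.

Lemma eq_modn_near (k a b : nat) : a = b %[mod k] -> a < b + k -> b < a + k -> a = b.
Proof.
wlog le_ba : a b / b <= a.
  by move=> IH Eab lta ltb; have [/IH->|/ltnW/IH->] := leqP b a.
move/eqP; rewrite eqn_mod_dvd // => /dvdnP[[|d]]; first lia.
by rewrite mulSn; lia.
Qed.

(** Parity tells the two ends of the edge apart, so the even ends agree and [o], [r] are both next
    to that position. They are congruent modulo [k] and at most 2 apart, hence equal. *)
Lemma zigzag_common_edge {m k} (pi si : {perm 'I_m}) (p p' q q' : 'I_(m * k)) (i : 'I_m) :
  2 < k -> ~~ odd k -> p' = p.+1 :> nat -> q' = q.+1 :> nat ->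
  i * k <= p < i * k + k ->
  [set zigzag k pi p; zigzag k pi p'] = [set zigzag k si q; zigzag k si q'] ->
  pi i = si i.
Proof.
move=> k_gt2 k_even Ep Eq p_win.
have [e [o [even_e odd_o eo ->]]] := zigzag_edge pi p p' Ep.
have [f [r [even_f odd_r fr ->]]] := zigzag_edge si q q' Eq.
have odd_zo : odd (zigzag k pi o) by rewrite odd_zigzag.
have odd_zr : odd (zigzag k si r) by rewrite odd_zigzag.
move=> E; have Ee : e = f.
  by have := set21 e (zigzag k pi o); rewrite E => /set2P[] // Ee; rewrite Ee odd_zr in even_e.
have Eo : zigzag k pi o = zigzag k si r.
  by have := set22 e (zigzag k pi o); rewrite E => /set2P[] // Eo;
     rewrite Eo (negPf even_f) in odd_zo.
have [Epi Emod] := eq_zigzag_odd _ _ _ _ odd_o odd_r Eo.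
have near : o <= r + 2 /\ r <= o + 2.
  by move: Ee eo fr => /(congr1 val) /= Ee eo fr;
     case: eo => -[Ee1 Eo1]; case: fr => -[Ef1 Er1]; subst; lia.
have Eor : o = r by apply/val_inj; apply: eq_modn_near Emod _ _ => /=; lia.
rewrite -Eor in Epi.
(* The last edge of the window ends in the next block, but at an even position; the odd end stays in
   block [i]. *)
have o_neq : o != (i * k + k) :> nat.
  by apply: contraTneq odd_o => ->; rewrite -mulSnr oddM (negPf k_even) andbF.
have o_win : i * k <= o < i * k + k by case: eo o_neq => -[_ ->]; lia.
suff <- : block o = i by [].
apply/val_inj => /=; have -> : val o = i * k + (o - i * k) by rewrite /=; lia.
by rewrite divnMDl ?divn_small ?addn0 //; lia.
Qed.

(** The witness is the stretch of [k + 1] vertices from position [i * k] on. Its nonemptiness and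
    its inclusion in the path serve to prove [zigzag_path] injective. *)
Lemma zigzag_locally_separated {m k} (pi si : {perm 'I_m}) (i : 'I_m) :
  2 < k -> ~~ odd k -> i.+1 < m -> pi i != si i ->
  exists P, [/\ subpath k P (zigzag_path k pi), P != set0,
                P \subset zigzag_path k pi & [disjoint P & zigzag_path k si]].
Proof.
move=> k_gt2 k_even lt_i neq_i.
have win_i : i * k + k.+1 <= m * k by nia.
have n_gt0 : 0 < m * k by lia.
pose x0 := Ordinal n_gt0; pose s := zigzag_tuple k pi.
have size_t : size (take k.+1 (drop (i * k) s)) == k.+1.
  by rewrite size_takel // size_drop size_tuple; lia.
pose t : k.+1.-tuple 'I_(m * k) := Tuple size_t.
have nth_t p : p <= k -> nth x0 t p = nth x0 s (i * k + p).
  by move=> lep; rewrite nth_take // nth_drop.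
have tr_s := zigzag_traverses pi k_even.
have tP e : e \in path_edges t -> exists2 p, i * k <= p < i * k + k &
    e = [set nth x0 s p; nth x0 s p.+1].
  case/(path_edgesP x0) => p; rewrite size_tuple ltnS => ltp ->.
  by exists (i * k + p); [lia | rewrite !nth_t ?addnS // ltnW].
have sE si' e : e \in zigzag_path k si' -> exists p q : 'I_(m * k),
    q = p.+1 :> nat /\ e = [set zigzag k si' p; zigzag k si' q].
  have /andP[_ /eqP->] := zigzag_traverses si' k_even.
  case/(path_edgesP x0) => p; rewrite size_tuple => ltp ->.
  exists (Ordinal (ltnW ltp)), (Ordinal ltp); split => //.
  by rewrite -!(nth_zigzag_tuple _ x0).
exists (path_edges t); split.
- apply/existsP; exists s; apply/existsP; exists t; rewrite tr_s eqxx andbT /=.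
  exact: infix_trans (infix_take _ _) (infix_drop _ _).
- apply/set0Pn; exists [set nth x0 t 0; nth x0 t 1].
  by apply/(path_edgesP x0); exists 0; rewrite ?size_tuple //; lia.
- apply/subsetP=> e /tP[p p_win ->]; have /andP[_ /eqP->] := tr_s.
  by apply/(path_edgesP x0); exists p; rewrite ?size_tuple //; lia.
rewrite disjoint_subset; apply/subsetP=> e /tP[p p_win Ee].
rewrite inE; apply: contra neq_i => /sE[q [q' [Eq Ee']]].
have ltp : p.+1 < m * k by lia.
apply/eqP; apply: (zigzag_common_edge pi si (Ordinal (ltnW ltp)) (Ordinal ltp) q q') => //.
by rewrite -Ee' Ee -!(nth_zigzag_tuple _ x0).
Qed.

(* The [k] edges that start in the last block do not all exist, so the blocks
   compared must be followed by another one. *)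
Lemma perm_neq_not_last {m} (pi si : {perm 'I_m}) :
  pi != si -> exists2 i : 'I_m, i.+1 < m & pi i != si i.
Proof.
(* If the block found is the last one, the block that [pi] sends to [si i] is another place of
   disagreement. *)
move=> neq; have [i neq_i] : exists i, pi i != si i.
  by apply/existsP; apply: contraR neq => /existsPn E; apply/eqP/permP=> i; apply/eqP/negPn/E.
have [lt_i|last_i] := ltnP i.+1 m; first by exists i.
pose j := (pi^-1)%g (si i); have Ej : pi j = si i by rewrite permKV.
have neq_ij : j != i by apply: contraNneq neq_i => E; rewrite -{1}E Ej.
exists j; last by rewrite Ej (inj_eq perm_inj) eq_sym.
have neq_ij' : j != i :> nat by [].
by have := ltn_ord i; have := ltn_ord j; lia.
Qed.

(** Equal paths would make a nonempty subpath disjoint from a path that contains it. *)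
Lemma zigzag_path_inj {m k} : 2 < k -> ~~ odd k -> injective (@zigzag_path m k).
Proof.
move=> k_gt2 k_even pi si E; apply/eqP/negPn/negP => /perm_neq_not_last[i lt_i neq_i].
have [P [_ /set0Pn[e eP] /subsetP sub]] :=
  zigzag_locally_separated pi si i k_gt2 k_even lt_i neq_i.
by rewrite -E => /disjointFr/(_ eP); rewrite sub.
Qed.

Lemma zigzag_separated_family {m k} :
  2 < k -> ~~ odd k ->
  separated_family k [set zigzag_path k pi | pi : {perm 'I_m}].
Proof.
move=> k_gt2 k_even; apply/andP; split.
  apply/forall_inP=> _ /imsetP[pi _ ->]; apply/existsP; exists (zigzag_tuple k pi).
  exact: zigzag_traverses.
apply/forall_inP=> _ /imsetP[pi _ ->]; apply/forall_inP=> _ /imsetP[si _ ->].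
apply/implyP=> neq.
have [|i lt_i neq_i] := perm_neq_not_last pi si; first by apply: contraNneq neq => ->.
have [P [subP _ _ disjP]] := zigzag_locally_separated pi si i k_gt2 k_even lt_i neq_i.
by apply/existsP; exists P; rewrite subP disjP.
Qed.

Theorem theorem2 (k n : nat) (hk : 2 < k) (k_even : ~~ odd k)
    (hn : 0 < n) (hkn : k %| n) :
  (n %/ k)`! <= M n k /\ M n k <= 3 ^ n * (n %/ k)`!.
Proof.
case/dvdnP: hkn hn => m -> hn; rewrite mulnK ?(ltnW (ltnW hk)) //; split.
  have <- : #|[set zigzag_path k pi | pi : {perm 'I_m}]| = m`!.
    by rewrite card_imset ?card_Sn //; apply: zigzag_path_inj.
  by apply: leq_bigmax_cond; apply: zigzag_separated_family.
by apply/bigmax_leqP=> F; apply: separated_family_card.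
Qed.
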